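(* Every cancellative commutative locally compact connected Hausdorff topological monoid with open shifts is a topological group.
   Context: A topological monoid is a monoid $S$ with a topology such that the operation $S\times S\to S$ is jointly continuous. It has open shifts if for every $a\in S$ and every open $U\subseteq S$ the sets $aU$ and $Ua$ are open in $S$. A space is locally compact if each point has a compact neighborhood. Being a topological group means that, with its given operation and topology, $S$ is a group and inversion is continuous (as well as multiplication). *)

(* Defs.v *)
From HB Require Import structures.
From mathcomp Require Import all_boot.
From mathcomp Require Import boolp classical_sets topology.

Set Implicit Arguments.
Unset Strict Implicit.
Unset Printing Implicit Defensive.

Local Open Scope classical_set_scope.
Local Open Scope group_scope.

#[short(type="preTopologicalMonoidType")]
HB.structure Definition PreTopologicalMonoid :=
  {S of Topological S & Monoid S}.

HB.mixin Record PreTopologicalMonoid_isTopologicalMonoid S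
    & PreTopologicalMonoid S := {
  mulg_continuous : continuous (fun p : S * S => p.1 * p.2)
}.

#[short(type="topologicalMonoidType")]
HB.structure Definition TopologicalMonoid :=
  {S of PreTopologicalMonoid S & PreTopologicalMonoid_isTopologicalMonoid S}.

Definition open_shifts (S : preTopologicalMonoidType) : Prop :=
  forall (a : S) (U : set S), open U ->
    open [set a * x | x in U] /\ open [set x * a | x in U].

(* [right_injective] is left cancellation (every [x |-> a * x] is injective)
   and [left_injective] is right cancellation. *)
Definition cancellative (S : monoidType) : Prop :=
  right_injective (@mul S) /\ left_injective (@mul S).

Definition is_topological_group (S : preTopologicalMonoidType) : Prop :=
  continuous (fun p : S * S => p.1 * p.2) /\
  exists inv : S -> S,
    [/\ left_inverse 1 inv (@mul S), right_inverse 1 inv (@mul S)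
      & continuous inv].

(* The library's [locally_compact] asks for compact neighborhoods that are also
   closed; for Hausdorff spaces this is the existence of compact ones. *)
Lemma hausdorff_locally_compactE (T : topologicalType) : hausdorff_space T ->
  locally_compact [set: T] <->
  forall x : T, exists2 K : set T, nbhs x K & compact K.
Proof.
move=> hT; split=> [lc x|lc x _].
  by have [K] := lc x I; rewrite withinET => xK [cK _]; exists K.
have [K xK cK] := lc x; exists K; first by rewrite withinET.
by split=> //; exact: compact_closed.
Qed.

(* Main.v *)
Require Import Defs.
From mathcomp Require Import all_boot.
From mathcomp Require Import boolp classical_sets topology.

Local Open Scope classical_set_scope.
Local Open Scope group_scope.

(** The heart of the matter is local ([nbhs1_invertible]): every neighborhood
    [W] of [1] contains the inverses of all points sufficiently close to [1].
    This is an Ellis-type argument, carried out inside the monoid.  If it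
    fails, local compactness gives compact neighborhoods [C n] of [1] with
    [C n.+1 * C n.+1 `<=` C n] and [C 0 * C 0 `<=` W], and then points [x n] in
    [C n.+1] that have no inverse in [W].  The products
    [y n = x 0 * ... * x n.-1] all lie in the compact set [C 0], so they have a
    cluster point [p].  Two descriptions of [p] collide.  On the one hand,
    [y m] belongs to the compact, hence closed, set [y n * C n] for all
    [m >= n], so that [p] is in [y n * C n] for every [n].  On the other hand,
    open shifts make [p * C 0] a neighborhood of [p], so that some [y n] is
    [p * w] with [w] in [C 0].  Writing [p = y n.+1 * z = y n * x n * z] and
    cancelling [y n] yields [x n * (z * w) = 1] with [z * w] in [W], which is
    absurd.

    Connectedness then spreads invertibility from a neighborhood of [1] to the
    whole monoid, because the invertible elements form a clopen set
    ([invertible_all]).  Finally the local statement says precisely that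
    inversion is continuous at [1], and translation carries this to every
    point. *)

Lemma mulgl_continuous {S : topologicalMonoidType} (a : S) :
  continuous (fun x : S => a * x).
Proof.
move=> x.
apply: (@continuous2_cvg _ _ _ _ _ _ (fun _ => a) id (fun u v : S => u * v)).
- exact: mulg_continuous (a, x).
- exact: cvg_cst.
- exact: cvg_id.
Qed.

Lemma nbhs_shift {S : topologicalMonoidType} (a : S) (A : set S) :
  open_shifts S -> nbhs 1 A -> nbhs a [set a * x | x in A].
Proof.
move=> shifts; rewrite nbhsE => -[U [oU U1] UA].
apply: filterS (image_subset _ UA) _; apply: open_nbhs_nbhs.
by split; [exact: (shifts a U oU).1 | exists 1; rewrite ?mulg1].
Qed.

(** Local compactness enters twice: it makes the space regular at [1], which
    lets [C] shrink inside a neighborhood whose square is in [A], and it makes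
    that [C] compact. *)
Lemma nbhs1_compact_square {S : topologicalMonoidType} (A : set S) :
  hausdorff_space S -> locally_compact [set: S] -> nbhs 1 A ->
  exists C : set S, [/\ nbhs 1 C, compact C, C `<=` A
    & forall x y, C x -> C y -> A (x * y)].
Proof.
move=> hS lcS A1.
have [K K1 [cK _]] := lcS 1 I; rewrite withinET in K1.
have : nbhs ((1 : S), (1 : S)) [set p : S * S | A (p.1 * p.2)].
  by apply: (mulg_continuous (1, 1)); rewrite /= mulg1.
move=> [[P Q] /= [P1 Q1] PQA].
have [D D1 DPQA] := compact_regular hS cK K1 (filterI A1 (filterI P1 Q1)).
exists (K `&` closure D); split.
- by apply: filterI => //; apply: filterS D1; exact: subset_closure.
- apply: compact_closedI => //; exact: closed_closure.
- by move=> x [_ /DPQA[]].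
- by move=> x y [_ /DPQA[_ [Px _]]] [_ /DPQA[_ [_ Qy]]]; exact: (PQA (x, y)).
Qed.

(** Since [C n.+1 * C n.+1 `<=` C n], a product of points of [C n.+1],
    [C n.+2], ... collapses from the right into a single point of [C n],
    whatever its length. *)
Lemma prod_tail {S : monoidType} (C : nat -> set S) (x : nat -> S) (n k : nat) :
  (forall n, C n 1) -> (forall n, C n.+1 (x n)) ->
  (forall n a b, C n.+1 a -> C n.+1 b -> C n (a * b)) ->
  exists2 c, C n c & \prod_(i < n + k) x i = \prod_(i < n) x i * c.
Proof.
move=> C1 Cx CM; elim: k n => [|k IHk] n; first by exists 1; rewrite ?addn0 ?mulg1.
have [c Cc yE] := IHk n.+1; exists (x n * c); first exact: CM.
by rewrite addnS -addSn yE big_ord_recr /= mulgA.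
Qed.

(** The choice of [W] being free, this gives both the invertibility of the
    points near [1] and the continuity of inversion at [1]. *)
Lemma nbhs1_invertible {S : topologicalMonoidType} (W : set S) :
  right_injective (@mul S) -> hausdorff_space S ->
  locally_compact [set: S] -> open_shifts S -> nbhs 1 W ->
  \forall x \near (1 : S), exists2 x', W x' & x * x' = 1.
Proof.
move=> mulI hS lcS shifts W1; apply: contrapT => nW.
have [C0 [C0_1 cC0 _ C0M]] := nbhs1_compact_square _ hS lcS W1.
have /choice[N N_P] (A : set S) : exists B, nbhs 1 A ->
    [/\ nbhs 1 B, compact B, B `<=` A & forall x y, B x -> B y -> A (x * y)].
  have [/(nbhs1_compact_square _ hS lcS)[B BP]|nA] := pselect (nbhs 1 A).
    by exists B.
  by exists A => /nA.
have /choice[f fP] (A : set S) : exists x, nbhs 1 A ->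
    A x /\ ~ exists2 x', W x' & x * x' = 1.
  have [A1|nA] := pselect (nbhs 1 A); last by exists 1 => /nA.
  apply: contrapT => /forallNP Af; apply: nW; apply: filterS A1 => x Ax.
  by apply: contrapT => nx; apply: (Af x).
pose C n := iter n N C0; pose x n := f (C n.+1); pose y n := \prod_(i < n) x i.
have C1 n : nbhs 1 (C n) by elim: n => [//|n /N_P[]].
have cC n : compact (C n) by case: n => [//|n]; have [] := N_P _ (C1 n).
have C_sub n : C n `<=` C0.
  by elim: n => [//|n IHn]; have [_ _ + _] := N_P _ (C1 n); move/subset_trans; apply.
have tail n k : exists2 c, C n c & y (n + k)%N = y n * c.
  apply: prod_tail => {}n; first exact: nbhs_singleton.
  - by have [] := fP _ (C1 n.+1).
  - by have [_ _ _] := N_P _ (C1 n).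
have [|p [_ yp]] := cC0 (y @ \oo) _.
  exists 0%N => // k _; have [c C0c] := tail 0%N k.
  by rewrite add0n [y 0%N]big_ord0 mul1g /= => ->.
have p_tail n : exists2 z, C n z & p = y n * z.
  have cT : compact [set y n * z | z in C n].
    apply: continuous_compact (cC n).
    by apply: continuous_subspaceT; exact: mulgl_continuous.
  suff [z Cz <-] : [set y n * z | z in C n] p by exists z.
  apply: (compact_closed hS cT) => A pA.
  apply: yp => //; exists n => // m /= /subnKC <-.
  by have [c Cc ->] := tail n (m - n)%N; exists c.
have [q [[n _ <-] [w C0w yE]]] :
    range y `&` [set p * w | w in C0] !=set0.
  apply: yp; first by exists 0%N => // n _; exists n.
  exact: nbhs_shift.
have [z Cz pE] := p_tail n.+1.
have [_] := fP _ (C1 n.+1); apply; exists (z * w).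
  by apply: C0M => //; apply: C_sub Cz.
apply: (mulI (y n)); rewrite mulg1 -[in RHS]yE pE [y n.+1]big_ord_recr /=.
by rewrite !mulgA.
Qed.

(** Around an invertible [a], the shift of a neighborhood of [1] made of
    invertible elements consists of invertible elements, so the invertible
    elements form an open set.  It is also closed: the shift of the whole
    monoid by a point [a] of the closure is a neighborhood of [a], so some
    [a * v] is invertible, and a left factor of an invertible element is
    invertible. *)
Lemma invertible_all {S : topologicalMonoidType} :
  connected [set: S] -> open_shifts S ->
  (\forall x \near (1 : S), exists x', x * x' = 1) ->
  forall x : S, exists x', x * x' = 1.
Proof.
move=> conS shifts inv1 x.
pose B : set S := [set x | exists x', x * x' = 1].
suff BT : B = [set: S] by suff : B x by []; rewrite BT.
have openB : open B.
  rewrite openE => a [a' aa'].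
  apply: filterS (nbhs_shift a _ shifts inv1).
  move=> _ [v [v' vv'] <-]; exists (v' * a').
  by rewrite mulgA -(mulgA a) vv' mulg1.
have closedB : closed B.
  move=> a /(_ [set a * v | v in setT])[|b [[c bc] [v _ avb]]].
    exact: nbhs_shift filterT.
  by exists (v * c); rewrite mulgA avb.
apply: conS; first by exists 1, 1; rewrite mulg1.
- by exists B; rewrite ?setTI.
- by exists B; rewrite ?setTI.
Qed.

Theorem corollary3p6 (S : topologicalMonoidType)
  (S_cancel : cancellative S)
  (S_comm : commutative (@mul S))
  (S_lcompact : locally_compact [set: S])
  (S_connected : connected [set: S])
  (S_hausdorff : hausdorff_space S)
  (S_shifts : open_shifts S) :
  is_topological_group S.
Proof.
have [mulI _] := S_cancel.
have near1_inv W : nbhs 1 W ->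
    \forall x \near (1 : S), exists2 x', W x' & x * x' = 1.
  exact: nbhs1_invertible.
have /choice[inv invP] : forall x : S, exists x', x * x' = 1.
  apply: invertible_all => //; apply: filterS (near1_inv setT filterT) => x.
  by case=> x' _ xx'; exists x'.
split; first exact: mulg_continuous.
exists inv; split=> [x||a A Aa]; [by rewrite S_comm invP | exact: invP |].
have A1 : nbhs 1 [set x | A (inv a * x)].
  by apply: (mulgl_continuous (inv a) 1); rewrite mulg1.
apply: filterS (nbhs_shift a _ S_shifts (near1_inv _ A1)) => _ [v [v' Av' vv'] <-] /=.
suff -> : inv (a * v) = inv a * v' by [].
apply: (mulI (a * v)); rewrite invP mulgA -(mulgA a) (S_comm v) mulgA invP.
by rewrite mul1g.
Qed.
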